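(* Let $S$ be a finite non-empty symmetric normalized set of real numbers and let $M = \max(S)$. Then there is no sequence of numbers $\lambda_n \in \Sigma_S \setminus \mathbb{R}$ such that $|\lambda_n| \rightarrow \frac{1}{\sqrt{M}+1}$. Moreover, $$\frac{1}{\sqrt{M}+1} < \rho_{out}(S) \leqslant \frac{1}{\sqrt{M+k}}$$ for $k = \max \{ s \in S \mid 1 \leqslant s < 2\sqrt{M} + 1 \}$.
   Context: $\mathbb{D}$ is the open unit disc in $\mathbb{C}$. For a non-empty bounded set $S$ of complex numbers, $\Sigma_S = \{ z \in \mathbb{D} \mid \exists\, p_0, p_1, \ldots \in S,\ p_0 \neq 0,\ \sum_{j=0}^\infty p_j z^j = 0 \}$. A set $S$ is symmetric if $S = -S$. A finite non-empty set $S$ of real numbers is normalized if $1 \in S$ and $|s| \geqslant 1$ for every $s \in S$ with $s \neq 0$. For a non-empty normalized finite set $S$ of real numbers, $\rho_{out}(S) = \sup \{ R > 0 \mid (\Sigma_S \setminus \mathbb{R}) \subseteq A_R \}$, where $A_R = \{ z \in \mathbb{C} \mid R \leqslant |z| < 1\}$. *)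

(* Defs.v *)
From Stdlib Require Import Reals Ensembles Finite_sets.
From Coquelicot Require Import Coquelicot.
Open Scope R_scope.

Definition unit_disc : Ensemble C := fun z => Cmod z < 1.

Definition real_line : Ensemble C := fun z => Im z = 0.

Definition embed (S : Ensemble R) : Ensemble C :=
  fun z => exists s : R, S s /\ z = RtoC s.

Definition Sigma (S : Ensemble C) : Ensemble C := fun z =>
  unit_disc z /\
  exists p : nat -> C,
    (forall j, S (p j)) /\ p 0%nat <> RtoC 0 /\
    is_pseries (K := C_AbsRing) (V := C_NormedModule) p z (RtoC 0).

Definition nonreal_Sigma (S : Ensemble R) : Ensemble C :=
  Setminus C (Sigma (embed S)) real_line.

Definition symmetric_set (S : Ensemble R) : Prop :=
  forall s : R, S s <-> S (- s).

Definition normalized (S : Ensemble R) : Prop :=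
  S 1 /\ forall s : R, S s -> s <> 0 -> 1 <= Rabs s.

Definition is_max (S : Ensemble R) (m : R) : Prop :=
  S m /\ forall s : R, S s -> s <= m.

Definition annulus (r : R) : Ensemble C := fun z => r <= Cmod z < 1.

(* The supremum is taken in the extended reals: it is [p_infty] when there is
   no nonreal zero, and never a junk real value. *)
Definition rho_out (S : Ensemble R) : Rbar :=
  Lub_Rbar (fun r => 0 < r /\ Included C (nonreal_Sigma S) (annulus r)).

(* Main.v *)
Require Import Defs.
From Stdlib Require Import Reals Ensembles Finite_sets.
From Coquelicot Require Import Coquelicot.
From Stdlib Require Import Lra Lia.
Open Scope R_scope.

(** Put [t = sqrt M] and [r = 1 / (t + 1)].  Let [f] be a power series with
    coefficients [p_j] in [S], [p_0 <> 0], and a nonreal zero [l] in the disc.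
    Replacing [f (z)] by [± f (± z)] (possible as [S = - S]) one may assume
    [p_0 >= 1] and [Re l >= 0].  The conjugate of [l] is also a zero, so
    [f (z) = (z - l) (z - conj l) Q (z)].  Dividing by one linear factor costs
    a factor [1 / (1 - |l|)] in the bound on the coefficients
    ([quotient_bound]), hence the coefficients [q_i] of [Q] are at most
    [B = M / (1 - |l|)^2].  Since [p_0 = |l|^2 q_0], this gives
    [1 <= |l|^2 B], i.e. [|l| >= r].

    All that remains is to exclude an interval [|l| < r + eps].  If [|l|] is
    close to [r], the estimate just used is almost an equality
    ([coeff_constraints]): [p_0] is close to [1], [Re l] is close to [|l|],
    and therefore [p_1 = |l|^2 q_1 - 2 (Re l) q_0] cannot much exceed
    [1 - 2 (t + 1) = - (2 t + 1)].  As [S] is finite, [p_0 = 1] and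
    [p_1 <= - (2 t + 1)] hold exactly.  In particular [M >= 2 t + 1 > 1].
    Now [f (r)] is seen in two ways.  On one hand, [p_j <= M] gives
<<
      f (r) <= 1 - (2 t + 1) r + M r^2 / (1 - r) = 0 ;
>>
    the limiting series [1 - (2 t + 1) z + M z^2 + M z^3 + ...] is
    [(1 - z / r)^2 / (1 - z)], with a double zero at [r].  On the other hand
    [f (r) = |r - l|^2 Q (r)], and [q_0 >= 1 / |l|^2], [|q_i| <= B] give
    [Re Q (r) >= 1 / |l|^2 - B r / (1 - r)], which is positive for [|l|] close
    to [r] because [r < 1 / 2] when [M > 1] ([positive_at_real]).  This
    contradiction is [radius_gap]; it yields both the absence of a sequence
    and the strict lower bound for [rho_out].

    For the upper bound, [1 - k z + M z^2 + M z^3 + ...] equals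
    [(1 - (k + 1) z + (M + k) z^2) / (1 - z)]; the condition
    [k < 2 t + 1] says that the quadratic has negative discriminant, so its
    zeros are nonreal, of modulus [1 / sqrt (M + k)] ([extremal_zero]). *)

(** * Partial sums and zeros of complex power series *)

(** Everything below is proved with these finite sums and telescoping
    identities between them; summability enters only through [vanishes_at]. *)
Fixpoint psum (p : nat -> C) (z : C) (n : nat) : C :=
  match n with
  | O => p O
  | S m => (psum p z m + p (S m) * z ^ S m)%C
  end.

Definition vanishes_at (p : nat -> C) (z : C) : Prop :=
  is_lim_seq (fun n => Cmod (psum p z n)) 0.

Lemma sum_n_psum (p : nat -> C) (z : C) (n : nat) :
  sum_n (fun k => scal (K := C_AbsRing) (V := C_NormedModule)
                    (pow_n (K := C_AbsRing) z k) (p k)) n = psum p z n.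
Proof.
  assert (Hpow : forall k, pow_n (K := C_AbsRing) z k = (z ^ k)%C).
  { induction k as [|k IH]; [reflexivity|].
    simpl. rewrite IH. reflexivity. }
  induction n as [|n IH].
  - rewrite sum_O, Hpow. simpl. apply Cmult_1_l.
  - rewrite sum_Sn, IH, Hpow. cbn [psum].
    change (psum p z n + z ^ S n * p (S n) = psum p z n + p (S n) * z ^ S n)%C.
    rewrite (Cmult_comm (p (S n))). reflexivity.
Qed.

Lemma is_pseries_vanishes_at (p : nat -> C) (z : C) :
  is_pseries (K := C_AbsRing) (V := C_NormedModule) p z (RtoC 0) <->
  vanishes_at p z.
Proof.
  unfold is_pseries, is_series, vanishes_at, is_lim_seq.
  split; intros H.
  - apply (filterlim_ext
             (fun n => norm (K := C_AbsRing) (V := C_NormedModule)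
                (sum_n (fun k => scal (K := C_AbsRing) (V := C_NormedModule)
                    (pow_n (K := C_AbsRing) z k) (p k)) n))).
    + intros n. rewrite sum_n_psum. reflexivity.
    + simpl. rewrite <- Cmod_0.
      eapply filterlim_comp; [exact H|].
      apply (filterlim_norm (K := C_AbsRing) (V := C_NormedModule)).
  - apply (filterlim_norm_zero (K := C_AbsRing) (V := C_NormedModule)).
    revert H. apply filterlim_ext.
    intros n. rewrite sum_n_psum. reflexivity.
Qed.

Lemma psum_conj (p : nat -> R) (z : C) (n : nat) :
  psum (fun j => RtoC (p j)) (Cconj z) n =
  Cconj (psum (fun j => RtoC (p j)) z n).
Proof.
  assert (Hr : forall x : R, Cconj (RtoC x) = RtoC x).
  { intros x. unfold Cconj, RtoC. simpl. f_equal. lra. }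
  induction n as [|n IH]; cbn [psum].
  - symmetry. apply Hr.
  - rewrite IH, Cplus_conj, Cmult_conj, Hr, Cpow_conj. reflexivity.
Qed.

Lemma geom_lim0 (K x : R) : 0 <= x < 1 -> is_lim_seq (fun n => K * x ^ n) 0.
Proof.
  intros Hx.
  replace (Finite 0) with (Rbar_mult K 0) by (simpl; f_equal; ring).
  apply is_lim_seq_scal_l, is_lim_seq_geom.
  rewrite Rabs_pos_eq; lra.
Qed.

(** * Dividing a power series by a linear factor *)

(** Coefficientwise form of [p = (z - l) * g]. *)
Definition quotient (l : C) (p g : nat -> C) : Prop :=
  p O = (- (l * g O))%C /\ forall i, p (S i) = (g i - l * g (S i))%C.

(** The terms of [(z - l) g (z)] telescope, with a remainder at the cut. *)
Lemma psum_quotient (l : C) (p g : nat -> C) (w : C) (n : nat) :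
  quotient l p g ->
  psum p w n = ((w - l) * psum g w n - w ^ S n * g n)%C.
Proof.
  intros [H0 HS]. induction n as [|n IH]; cbn [psum].
  - rewrite H0. simpl. ring.
  - rewrite IH, HS. rewrite !Cpow_S. ring.
Qed.

(** Unrolling [g_i = p_(i+1) + l g_(i+1)] bounds [|g_i|] by a geometric sum
    plus [|l|^m |g_(i+m)|].  By [psum_quotient] at [w = l] this remainder is,
    up to a constant, the modulus of a partial sum of [p] at [l], so it tends
    to [0] exactly because [l] is a zero. *)
Lemma quotient_bound (l : C) (p g : nat -> C) (K : R) :
  Cmod l < 1 -> (forall j, Cmod (p j) <= K) -> quotient l p g ->
  vanishes_at p l -> l <> 0 -> forall i, Cmod (g i) <= K / (1 - Cmod l).
Proof.
  intros Hl HK Hq Hv Hl0 i.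
  assert (Hr : 0 < Cmod l) by now apply Cmod_gt_0.
  assert (HK0 : 0 <= K) by (eapply Rle_trans; [apply Cmod_ge_0 | apply (HK O)]).
  assert (Hstep : forall m,
    Cmod (g i) <= K / (1 - Cmod l) + Cmod l ^ m * Cmod (g (i + m)%nat)).
  { assert (Hpos : 0 <= K / (1 - Cmod l)) by (apply Rdiv_le_0_compat; lra).
    assert (Hm : forall m, Cmod (g i) <= K / (1 - Cmod l) * (1 - Cmod l ^ m)
                           + Cmod l ^ m * Cmod (g (i + m)%nat)).
    { induction m as [|m IH].
      - rewrite Nat.add_0_r. simpl. lra.
      - destruct Hq as [_ HS].
        assert (E : g (i + m)%nat = (p (S (i + m)) + l * g (S (i + m)))%C)
          by (rewrite HS; ring).
        assert (B : Cmod (g (i + m)%nat) <= K + Cmod l * Cmod (g (S (i + m)))).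
        { rewrite E. eapply Rle_trans; [apply Cmod_triangle|].
          rewrite Cmod_mult. specialize (HK (S (i + m))). lra. }
        rewrite Nat.add_succ_r.
        assert (0 <= Cmod l ^ m) by (apply pow_le; lra).
        apply (Rmult_le_compat_l (Cmod l ^ m)) in B; [|assumption].
        assert (K = K / (1 - Cmod l) * (1 - Cmod l)) by (field; lra).
        simpl pow. nra. }
    intros m. specialize (Hm m).
    assert (0 <= Cmod l ^ m) by (apply pow_le; lra). nra. }
  assert (Hlim : is_lim_seq
    (fun m => K / (1 - Cmod l) + Cmod l ^ m * Cmod (g (i + m)%nat))
    (K / (1 - Cmod l))).
  { replace (Finite (K / (1 - Cmod l)))
      with (Rbar_plus (K / (1 - Cmod l)) (Rbar_mult (/ Cmod l ^ S i) 0))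
      by (simpl; f_equal; ring).
    apply is_lim_seq_plus'; [apply is_lim_seq_const|].
    apply is_lim_seq_ext with
      (fun m => / Cmod l ^ S i * Cmod (psum p l (m + i)%nat)).
    - intros m. rewrite (psum_quotient l p g l _ Hq).
      replace ((l - l) * psum g l (m + i) - l ^ S (m + i) * g (m + i)%nat)%C
        with (- (l ^ S (m + i) * g (m + i)%nat))%C by ring.
      rewrite Cmod_opp, Cmod_mult, Cmod_pow.
      replace (S (m + i)) with (S i + m)%nat by lia.
      rewrite pow_add, (Nat.add_comm m i). field.
      apply pow_nonzero; lra.
    - apply (is_lim_seq_scal_l _ (/ Cmod l ^ S i) 0).
      apply (is_lim_seq_incr_n (fun m => Cmod (psum p l m)) i), Hv. }
  exact (is_lim_seq_le _ _ _ _ Hstep (is_lim_seq_const _) Hlim).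
Qed.

(** The recursion determines the quotient; only its boundedness depends on
    [l] being a zero. *)
Lemma quotient_exists (l : C) (p : nat -> C) :
  l <> 0 -> exists g, quotient l p g.
Proof.
  intros Hl.
  exists (fix g n := match n with
                     | O => (- p O / l)%C
                     | S m => ((g m - p (S m)) / l)%C
                     end).
  split; [field; exact Hl|]. intros i. field. exact Hl.
Qed.

Lemma quotient_vanishes (l w : C) (p g : nat -> C) (K : R) :
  Cmod w < 1 -> w <> l -> quotient l p g -> (forall i, Cmod (g i) <= K) ->
  vanishes_at p w -> vanishes_at g w.
Proof.
  intros Hw Hwl Hq Hg Hv.
  assert (Hwl' : 0 < Cmod (w - l)).
  { apply Cmod_gt_0. intros E. apply Hwl.
    replace w with (w - l + l)%C by ring. rewrite E. ring. }
  pose proof (Cmod_ge_0 w) as Hw0.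
  apply is_lim_seq_le_le with
    (u := fun _ => 0)
    (w := fun n => / Cmod (w - l) * (Cmod (psum p w n) + K * Cmod w * Cmod w ^ n)).
  - intros n. split; [apply Cmod_ge_0|].
    apply Rmult_le_reg_l with (Cmod (w - l)); [assumption|].
    rewrite <- Rmult_assoc, Rinv_r, Rmult_1_l by lra.
    rewrite <- Cmod_mult.
    replace ((w - l) * psum g w n)%C with (psum p w n + w ^ S n * g n)%C
      by (rewrite (psum_quotient l p g w n Hq); ring).
    eapply Rle_trans; [apply Cmod_triangle|].
    rewrite Cmod_mult, Cmod_pow. simpl pow.
    assert (0 <= Cmod w * Cmod w ^ n) by (apply Rmult_le_pos; [|apply pow_le]; lra).
    specialize (Hg n). nra.
  - apply is_lim_seq_const.
  - replace (Finite 0) with (Rbar_mult (/ Cmod (w - l)) (Rbar_plus 0 0))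
      by (simpl; f_equal; ring).
    apply is_lim_seq_scal_l, is_lim_seq_plus'; [exact Hv|].
    now apply geom_lim0.
Qed.

(** Used to certify a zero without summing the series: it suffices to exhibit
    a bounded quotient. *)
Lemma vanishes_of_quotient (l : C) (p g : nat -> C) (K : R) :
  Cmod l < 1 -> quotient l p g -> (forall i, Cmod (g i) <= K) ->
  vanishes_at p l.
Proof.
  intros Hl Hq Hg. pose proof (Cmod_ge_0 l) as Hl0.
  apply is_lim_seq_le_le with
    (u := fun _ => 0) (w := fun n => K * Cmod l * Cmod l ^ n).
  - intros n. split; [apply Cmod_ge_0|].
    rewrite (psum_quotient l p g l n Hq).
    replace ((l - l) * psum g l n - l ^ S n * g n)%C
      with (- (l ^ S n * g n))%C by ring.
    rewrite Cmod_opp, Cmod_mult, Cmod_pow. simpl pow.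
    assert (0 <= Cmod l * Cmod l ^ n) by (apply Rmult_le_pos; [|apply pow_le]; lra).
    specialize (Hg n). nra.
  - apply is_lim_seq_const.
  - now apply geom_lim0.
Qed.

(** * Dividing by a pair of conjugate zeros *)

Lemma nonreal_neq_conj (l : C) : Im l <> 0 -> Cconj l <> l /\ l <> 0.
Proof.
  intros H. split; intros E.
  - apply H. apply (f_equal Im) in E. rewrite im_conj in E. lra.
  - apply H. rewrite E. reflexivity.
Qed.

Lemma double_quotient (p : nat -> R) (M : R) (l : C) :
  (forall j, Rabs (p j) <= M) -> Cmod l < 1 -> Im l <> 0 ->
  vanishes_at (fun j => RtoC (p j)) l ->
  exists g q, quotient l (fun j => RtoC (p j)) g /\ quotient (Cconj l) g q /\
    (forall i, Cmod (g i) <= M / (1 - Cmod l)) /\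
    (forall i, Cmod (q i) <= M / (1 - Cmod l) ^ 2).
Proof.
  intros HM Hl Him Hv.
  destruct (nonreal_neq_conj l Him) as [Hc H0].
  assert (Hc0 : Cconj l <> 0).
  { intros E. apply H0. rewrite <- (Cconj_conj l), E.
    unfold Cconj, RtoC. simpl. f_equal. lra. }
  destruct (quotient_exists l (fun j => RtoC (p j)) H0) as [g Hg].
  destruct (quotient_exists (Cconj l) g Hc0) as [q Hq].
  assert (Bg : forall i, Cmod (g i) <= M / (1 - Cmod l)).
  { apply (quotient_bound l (fun j => RtoC (p j)) g M); auto.
    intros j. rewrite Cmod_R. apply HM. }
  exists g, q. repeat split; try (apply Hg || apply Hq); auto.
  intros i. replace (M / (1 - Cmod l) ^ 2)
    with (M / (1 - Cmod l) / (1 - Cmod (Cconj l))).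
  - apply (quotient_bound (Cconj l) g q); rewrite ?Cmod_conj; auto.
    apply (quotient_vanishes l _ (fun j => RtoC (p j)) g (M / (1 - Cmod l)));
      rewrite ?Cmod_conj; auto.
    unfold vanishes_at. revert Hv. apply is_lim_seq_ext.
    intros n. rewrite psum_conj, Cmod_conj. reflexivity.
  - rewrite Cmod_conj. field. lra.
Qed.

(** Low-order coefficients of [p = (z - l) (z - conj l) q].  The third identity
    mixes [g] and [q] on purpose: it expresses [q_0] so that the triangle
    inequality, with the bounds on [g] and [q], loses nothing when [l] is
    real, and it displays the dependence on [Re l]. *)
Lemma double_quotient_coeffs (p : nat -> R) (l : C) (g q : nat -> C) :
  quotient l (fun j => RtoC (p j)) g -> quotient (Cconj l) g q ->
  RtoC (p 0%nat) = (RtoC (Cmod l ^ 2) * q 0%nat)%C /\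
  RtoC (p 1%nat) =
    (RtoC (Cmod l ^ 2) * q 1%nat - RtoC (2 * Re l) * q 0%nat)%C /\
  q 0%nat =
    (RtoC (p 2%nat) + RtoC (2 * Re l) * g 2%nat + Cconj l ^ 2 * q 2%nat)%C.
Proof.
  intros [Hg0 Hg] [Hq0 Hq].
  assert (E2 : RtoC (2 * Re l) = (l + Cconj l)%C).
  { rewrite RtoC_mult, re_alt. field. }
  assert (E1 : RtoC (Cmod l ^ 2) = (l * Cconj l)%C).
  { apply Cmod2_conj. }
  rewrite Hg0, Hg, E1, E2, Hq0, !Hq.
  assert (E3 : RtoC (p 2%nat) = (g 1%nat - l * g 2%nat)%C) by apply Hg.
  rewrite E3, !Hq. repeat split; ring.
Qed.

(** The first inequality is [q_0 <= B] with [B = M / (1 - |l|)^2]; the second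
    measures how far [l] can be from [|l|] when [q_0] nearly reaches [B]; the
    third then pushes [p_1] down, since [2 (Re l) q_0] is large. *)
Lemma coeff_constraints (p : nat -> R) (M : R) (l : C) :
  (forall j, Rabs (p j) <= M) -> 1 <= p 0%nat ->
  Cmod l < 1 -> Im l <> 0 -> 0 <= Re l ->
  vanishes_at (fun j => RtoC (p j)) l ->
  p 0%nat <= Cmod l ^ 2 * (M / (1 - Cmod l) ^ 2) /\
  2 * (Cmod l - Re l) * (M / (1 - Cmod l)) <=
    M / (1 - Cmod l) ^ 2 - 1 / Cmod l ^ 2 /\
  p 1%nat <= Cmod l ^ 2 * (M / (1 - Cmod l) ^ 2) - 2 * Re l / Cmod l ^ 2.
Proof.
  intros HM Hp0 Hl Him Hre Hv.
  destruct (double_quotient p M l HM Hl Him Hv) as (g & q & Hg & Hq & Bg & Bq).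
  destruct (double_quotient_coeffs p l g q Hg Hq) as (E0 & E1 & E2).
  assert (Hr : 0 < Cmod l) by (apply Cmod_gt_0, nonreal_neq_conj, Him).
  set (rho := Cmod l) in *.
  assert (Hr2 : 0 < rho ^ 2) by (apply pow_lt; exact Hr).
  assert (Q0 : q 0%nat = RtoC (p 0%nat / rho ^ 2)).
  { rewrite RtoC_div, E0 by lra. field.
    intros E. apply RtoC_inj in E. lra. }
  assert (P0 : 1 / rho ^ 2 <= p 0%nat / rho ^ 2).
  { unfold Rdiv. apply Rmult_le_compat_r; [|lra].
    apply Rlt_le, Rinv_0_lt_compat, Hr2. }
  assert (P0' : 0 <= 1 / rho ^ 2) by (apply Rdiv_le_0_compat; lra).
  assert (N0 : Cmod (q 0%nat) = p 0%nat / rho ^ 2).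
  { rewrite Q0, Cmod_R, Rabs_pos_eq; lra. }
  split; [|split].
  - pose proof (Bq 0%nat) as B. rewrite N0 in B.
    apply (Rmult_le_compat_l (rho ^ 2)) in B; [|lra].
    replace (rho ^ 2 * (p 0%nat / rho ^ 2)) with (p 0%nat) in B by (field; lra).
    exact B.
  - assert (T : p 0%nat / rho ^ 2 <=
      M + 2 * Re l * (M / (1 - rho)) + rho ^ 2 * (M / (1 - rho) ^ 2)).
    { rewrite <- N0, E2.
      eapply Rle_trans; [apply Cmod_triangle|].
      apply Rplus_le_compat; [eapply Rle_trans; [apply Cmod_triangle|]|].
      - rewrite Cmod_mult, !Cmod_R.
        apply Rplus_le_compat; [apply HM|].
        rewrite (Rabs_pos_eq (2 * Re l)) by lra.
        apply Rmult_le_compat_l; [lra | apply Bg].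
      - rewrite Cmod_mult, Cmod_pow, Cmod_conj.
        apply Rmult_le_compat_l; [apply Rlt_le, Hr2 | apply Bq]. }
    (* [M / (1 - rho)^2] is the value of the bound when [Re l = rho] *)
    assert (I : M / (1 - rho) ^ 2 =
      M + 2 * rho * (M / (1 - rho)) + rho ^ 2 * (M / (1 - rho) ^ 2))
      by (field; lra).
    lra.
  - assert (E : RtoC (p 1%nat + 2 * Re l * (p 0%nat / rho ^ 2)) =
      (RtoC (rho ^ 2) * q 1%nat)%C).
    { rewrite RtoC_plus, E1, Q0, (RtoC_mult (2 * Re l)). ring. }
    apply (f_equal Cmod) in E. rewrite Cmod_mult, !Cmod_R in E.
    rewrite (Rabs_pos_eq (rho ^ 2)) in E by lra.
    pose proof (Bq 1%nat) as B.
    apply (Rmult_le_compat_l (rho ^ 2)) in B; [|lra].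
    rewrite <- E in B.
    pose proof (Rle_abs (p 1%nat + 2 * Re l * (p 0%nat / rho ^ 2))) as A.
    assert (2 * Re l * (1 / rho ^ 2) <= 2 * Re l * (p 0%nat / rho ^ 2))
      by (apply Rmult_le_compat_l; lra).
    replace (2 * Re l / rho ^ 2) with (2 * Re l * (1 / rho ^ 2)) by (field; lra).
    lra.
Qed.

(** * Sign of the series at a real point *)

Lemma psum_real_upper (p : nat -> R) (M x : R) (n : nat) :
  (forall j, p j <= M) -> 0 <= M -> 0 <= x < 1 ->
  Re (psum (fun j => RtoC (p j)) (RtoC x) (S n)) <=
  p 0%nat + p 1%nat * x + M * x ^ 2 / (1 - x).
Proof.
  intros HM HM0 Hx.
  assert (H : Re (psum (fun j => RtoC (p j)) (RtoC x) (S n)) <=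
    p 0%nat + p 1%nat * x + M * x ^ 2 / (1 - x) * (1 - x ^ n)).
  { induction n as [|n IH].
    - simpl. lra.
    - cbn [psum] in *. rewrite <- !RtoC_pow, <- !RtoC_mult in *.
      unfold Cplus in *. cbn [Re fst RtoC] in *.
      assert (0 <= x ^ S (S n)) by (apply pow_le; lra).
      pose proof (Rmult_le_compat_r _ _ _ H (HM (S (S n)))) as B.
      assert (E : M * x ^ S (S n) =
        M * x ^ 2 / (1 - x) * (x ^ n - x ^ S n)) by (simpl; field; lra).
      lra. }
  assert (0 <= x ^ n) by (apply pow_le; lra).
  assert (0 <= M * x ^ 2 / (1 - x)).
  { apply Rdiv_le_0_compat; [apply Rmult_le_pos; [lra | apply pow_le; lra]|lra]. }
  nra.
Qed.

Lemma psum_real_lower (q : nat -> C) (B x : R) (n : nat) :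
  (forall j, Cmod (q j) <= B) -> 0 <= x < 1 ->
  Re (q 0%nat) - B * x / (1 - x) <= Re (psum q (RtoC x) n).
Proof.
  intros HB Hx.
  assert (H : Re (q 0%nat) - B * x / (1 - x) * (1 - x ^ n)
              <= Re (psum q (RtoC x) n)).
  { induction n as [|n IH].
    - simpl. lra.
    - cbn [psum]. rewrite <- RtoC_pow.
      assert (0 <= x ^ S n) by (apply pow_le; lra).
      assert (A : Re (psum q (RtoC x) n + q (S n) * RtoC (x ^ S n))%C =
        Re (psum q (RtoC x) n) + Re (q (S n)) * x ^ S n).
      { unfold Re, Cplus, Cmult, RtoC. simpl. ring. }
      rewrite A.
      assert (- B <= Re (q (S n))).
      { pose proof (re_le_Cmod (q (S n))). pose proof (HB (S n)).
        pose proof (Rle_abs (- Re (q (S n)))). rewrite Rabs_Ropp in *. lra. }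
      assert (- B * x ^ S n <= Re (q (S n)) * x ^ S n)
        by (apply Rmult_le_compat_r; assumption).
      assert (E : B * x ^ S n = B * x / (1 - x) * (x ^ n - x ^ S n))
        by (simpl; field; lra).
      lra. }
  assert (0 <= x ^ n) by (apply pow_le; lra).
  assert (0 <= B) by (eapply Rle_trans; [apply Cmod_ge_0 | apply (HB O)]).
  assert (0 <= B * x / (1 - x)).
  { apply Rdiv_le_0_compat; [apply Rmult_le_pos|]; lra. }
  nra.
Qed.

(** At a real point [(x - l) (x - conj l) = |x - l|^2 > 0], so the series has
    the sign of its double quotient, whose constant coefficient dominates by
    hypothesis; and the series is at most the expression in the conclusion,
    because [p_j <= M] for [j >= 2]. *)
Lemma positive_at_real (p : nat -> R) (M : R) (l : C) (x : R) :
  (forall j, Rabs (p j) <= M) -> 1 <= p 0%nat ->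
  Cmod l < 1 -> Im l <> 0 -> vanishes_at (fun j => RtoC (p j)) l ->
  0 <= x < 1 ->
  0 < 1 / Cmod l ^ 2 - M / (1 - Cmod l) ^ 2 * x / (1 - x) ->
  0 < p 0%nat + p 1%nat * x + M * x ^ 2 / (1 - x).
Proof.
  intros HM Hp0 Hl Him Hv Hx Hc.
  destruct (double_quotient p M l HM Hl Him Hv) as (g & q & Hg & Hq & Bg & Bq).
  destruct (double_quotient_coeffs p l g q Hg Hq) as (E0 & _ & _).
  assert (Hr : 0 < Cmod l) by (apply Cmod_gt_0, nonreal_neq_conj, Him).
  set (rho := Cmod l) in *.
  assert (Hr2 : 0 < rho ^ 2) by (apply pow_lt; exact Hr).
  assert (Q0 : 1 / rho ^ 2 <= Re (q 0%nat)).
  { replace (q 0%nat) with (RtoC (p 0%nat / rho ^ 2)).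
    - simpl Re. unfold Rdiv. apply Rmult_le_compat_r; [|lra].
      apply Rlt_le, Rinv_0_lt_compat, Hr2.
    - rewrite RtoC_div, E0 by lra. field.
      intros E. apply RtoC_inj in E. lra. }
  set (c := 1 / rho ^ 2 - M / (1 - rho) ^ 2 * x / (1 - x)) in *.
  (* [d = |x - l|^2] *)
  assert (D : exists d, 0 < d /\ RtoC d = ((RtoC x - l) * (RtoC x - Cconj l))%C).
  { exists ((x - Re l) ^ 2 + Im l ^ 2). split.
    - pose proof (pow2_ge_0 (x - Re l)).
      assert (0 < Im l ^ 2) by (apply pow2_gt_0; exact Him). lra.
    - destruct l as [a b].
      unfold RtoC, Cminus, Cplus, Cmult, Copp, Cconj, Re, Im. simpl.
      f_equal; ring. }
  destruct D as (d & Hd & ED).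
  destruct (Rlt_or_le 0 (p 0%nat + p 1%nat * x + M * x ^ 2 / (1 - x)))
    as [H|H]; [exact H|exfalso].
  (* [K] bounds the cut-off term left by two applications of [psum_quotient] *)
  set (K := M / (1 - rho) + Cmod (RtoC x - l) * (M / (1 - rho) ^ 2)).
  assert (Hup : forall n, d * c <= K * x ^ n).
  { intros n.
    assert (E : psum (fun j => RtoC (p j)) (RtoC x) (S n) =
      (RtoC d * psum q (RtoC x) (S n) -
       RtoC (x ^ S (S n)) * (g (S n) + (RtoC x - l) * q (S n)))%C).
    { rewrite (psum_quotient l _ g _ _ Hg), (psum_quotient (Cconj l) g q _ _ Hq).
      rewrite ED, RtoC_pow. ring. }
    set (e := (g (S n) + (RtoC x - l) * q (S n))%C) in E.
    assert (Be : Cmod e <= K).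
    { unfold e, K. eapply Rle_trans; [apply Cmod_triangle|].
      rewrite Cmod_mult. apply Rplus_le_compat; [apply Bg|].
      apply Rmult_le_compat_l; [apply Cmod_ge_0 | apply Bq]. }
    apply (f_equal Re) in E.
    assert (ER : forall (u v : R) (z w : C),
      Re (RtoC u * z - RtoC v * w)%C = u * Re z - v * Re w).
    { intros u v z w. unfold Re, Cminus, Copp, Cplus, Cmult, RtoC. simpl. ring. }
    rewrite ER in E.
    assert (HM0 : 0 <= M)
      by (eapply Rle_trans; [apply Rabs_pos | apply (HM O)]).
    assert (U := psum_real_upper p M x n
                   (fun j => Rle_trans _ _ _ (Rle_abs _) (HM j)) HM0 Hx).
    assert (L := psum_real_lower q (M / (1 - rho) ^ 2) x (S n) Bq Hx).
    assert (Lc : c <= Re (psum q (RtoC x) (S n))) by (unfold c; lra).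
    apply (Rmult_le_compat_l d) in Lc; [|lra].
    assert (Re e <= K)
      by (pose proof (re_le_Cmod e); pose proof (Rle_abs (Re e)); lra).
    assert (X2 : 0 <= x ^ S (S n)) by (apply pow_le; lra).
    assert (X : x ^ S (S n) <= x ^ n).
    { simpl. assert (0 <= x ^ n) by (apply pow_le; lra).
      assert (0 <= x * x ^ n <= x ^ n) by nra. nra. }
    assert (0 <= K) by (eapply Rle_trans; [apply Cmod_ge_0 | exact Be]).
    nra. }
  assert (Hlim := is_lim_seq_le _ _ _ _ Hup (is_lim_seq_const _)
                    (geom_lim0 K x Hx)).
  simpl in Hlim. nra.
Qed.

(** * The annulus free of nonreal zeros *)

Lemma finite_right_gap (S : Ensemble R) (v : R) :
  Finite_sets.Finite R S ->
  exists d, 0 < d /\ forall s, S s -> v < s -> v + d <= s.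
Proof.
  intros HF. induction HF as [|A HA [d [Hd IH]] x Hx].
  - exists 1. split; [lra|]. intros s [].
  - destruct (Rlt_le_dec v x) as [Hv|Hv].
    + exists (Rmin d (x - v)). split; [apply Rmin_glb_lt; lra|].
      pose proof (Rmin_l d (x - v)). pose proof (Rmin_r d (x - v)).
      intros s [y Hy|y Hy] Hs.
      * specialize (IH y Hy Hs). lra.
      * inversion Hy; subst. lra.
    + exists d. split; [exact Hd|].
      intros s [y Hy|y Hy] Hs; [auto|].
      inversion Hy; subst. lra.
Qed.

(** Continuity at [r = 1 / (t + 1)], with [M = t^2]: there the first expression
    is [1], the second is [- (2 t + 1)], and the third is
    [(t + 1)^2 (t - 1) / t].  The first two are the bounds for [p_0] and [p_1]
    given by [coeff_constraints] (with [Re l] eliminated), the third is the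
    hypothesis of [positive_at_real] at [x = r]. *)
Lemma bounds_near_critical_radius (t d1 d2 : R) :
  1 <= t -> 0 < d1 -> 0 < d2 ->
  exists eps, 0 < eps /\ forall rho, Rabs (rho - 1 / (t + 1)) < eps ->
    rho ^ 2 * (t ^ 2 / (1 - rho) ^ 2) < 1 + d1 /\
    rho ^ 2 * (t ^ 2 / (1 - rho) ^ 2)
      - 2 * (rho - (t ^ 2 / (1 - rho) ^ 2 - 1 / rho ^ 2)
                   * (1 - rho) / (2 * t ^ 2)) / rho ^ 2
      < - (2 * t + 1) + d2 /\
    (1 < t -> 0 < 1 / rho ^ 2
       - t ^ 2 / (1 - rho) ^ 2 * (1 / (t + 1)) / (1 - 1 / (t + 1))).
Proof.
  intros Ht H1 H2. set (r := 1 / (t + 1)).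
  assert (Hr : 0 < r < 1).
  { unfold r. split; [apply Rdiv_lt_0_compat; lra|].
    apply Rlt_div_l; lra. }
  assert (R2 : 0 < r * r) by nra.
  assert (R3 : 0 < (1 - r) * (1 - r)) by nra.
  assert (L : forall (f : R -> R) (y : R), ex_derive f r -> f r < y ->
    locally r (fun rho => f rho < y)).
  { intros f y Hf Hy.
    apply (ex_derive_continuous f r Hf (fun z => z < y)).
    exact (open_lt y (f r) Hy). }
  assert (A1 : locally r (fun rho => rho ^ 2 * (t ^ 2 / (1 - rho) ^ 2) < 1 + d1)).
  { apply L; [auto_derive; lra|].
    replace (r ^ 2 * (t ^ 2 / (1 - r) ^ 2)) with 1 by (unfold r; field; lra).
    lra. }
  assert (A2 : locally r (fun rho => rho ^ 2 * (t ^ 2 / (1 - rho) ^ 2)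
      - 2 * (rho - (t ^ 2 / (1 - rho) ^ 2 - 1 / rho ^ 2)
                   * (1 - rho) / (2 * t ^ 2)) / rho ^ 2
      < - (2 * t + 1) + d2)).
  { apply L; [auto_derive; repeat split; nra|].
    match goal with |- ?A < _ => replace A with (- (2 * t + 1)) end; [lra|].
    unfold r. field. lra. }
  assert (A3 : locally r (fun rho => 1 < t -> 0 < 1 / rho ^ 2
       - t ^ 2 / (1 - rho) ^ 2 * r / (1 - r))).
  { destruct (Rlt_dec 1 t) as [H|H].
    - assert (A : locally r (fun rho => t ^ 2 / (1 - rho) ^ 2 * r / (1 - r)
                                - 1 / rho ^ 2 < 0)).
      { apply L; [auto_derive; repeat split; nra|].
        match goal with |- ?A < _ => replace A with (- ((t + 1) ^ 2 * (t - 1) / t)) end.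
        - assert (0 < (t + 1) ^ 2 * (t - 1) / t); [|lra].
          apply Rdiv_lt_0_compat; [|lra]. apply Rmult_lt_0_compat; [|lra].
          apply pow_lt; lra.
        - unfold r. field. lra. }
      revert A. apply filter_imp. intros rho A _. lra.
    - apply filter_forall. intros rho H'. lra. }
  destruct (filter_and _ _ A1 (filter_and _ _ A2 A3)) as [eps Heps].
  exists eps. split; [apply cond_pos|].
  intros rho Hrho. apply Heps. exact Hrho.
Qed.

(** For [s, t = ± 1] this is the passage from [f (z)] to [s f (t z)], which
    moves a zero [l] to [t l]. *)
Lemma psum_sign_change (p : nat -> R) (s t : R) (l : C) (n : nat) :
  t * t = 1 ->
  psum (fun j => RtoC (s * t ^ j * p j)) (RtoC t * l)%C n =
  (RtoC s * psum (fun j => RtoC (p j)) l n)%C.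
Proof.
  intros Ht.
  assert (Hj : forall j, (RtoC (s * t ^ j * p j) * (RtoC t * l) ^ j =
                         RtoC s * (RtoC (p j) * l ^ j))%C).
  { intros j. rewrite Cpow_mult_l, <- RtoC_pow.
    assert (E : t ^ j * t ^ j = 1) by (rewrite <- Rpow_mult_distr, Ht; apply pow1).
    transitivity (RtoC (s * (t ^ j * t ^ j) * p j) * l ^ j)%C.
    - rewrite !RtoC_mult. ring.
    - rewrite E, !RtoC_mult. ring. }
  induction n as [|n IH]; cbn [psum].
  - rewrite !RtoC_mult. simpl. ring.
  - rewrite IH, Hj. ring.
Qed.

Lemma sign_pow_mem (S : Ensemble R) (s t x : R) (j : nat) :
  symmetric_set S -> (s = 1 \/ s = -1) -> (t = 1 \/ t = -1) ->
  S x -> S (s * t ^ j * x).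
Proof.
  intros HS Hs Ht Hx.
  assert (H : s * t ^ j = 1 \/ s * t ^ j = -1).
  { induction j as [|j IH]; simpl.
    - now rewrite Rmult_1_r.
    - replace (s * (t * t ^ j)) with (t * (s * t ^ j)) by ring.
      destruct Ht as [-> | ->], IH as [-> | ->];
        ((left; lra) || (right; lra)). }
  destruct H as [-> | ->].
  - now rewrite Rmult_1_l.
  - replace (-1 * x) with (- x) by ring. exact (proj1 (HS x) Hx).
Qed.

Lemma nonreal_Sigma_wlog (S : Ensemble R) (z : C) :
  symmetric_set S -> normalized S -> nonreal_Sigma S z ->
  exists (p : nat -> R) (l : C),
    (forall j, S (p j)) /\ 1 <= p 0%nat /\ Cmod l = Cmod z /\ Cmod l < 1 /\
    Im l <> 0 /\ 0 <= Re l /\ vanishes_at (fun j => RtoC (p j)) l.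
Proof.
  intros HS [_ HN] [[Hz (pc & Hpc & Hp0 & Hser)] Him].
  unfold unit_disc, In in Hz. unfold real_line, In in Him.
  set (p := fun j => Re (pc j)).
  assert (Hp : forall j, S (p j) /\ pc j = RtoC (p j)).
  { intros j. destruct (Hpc j) as (s & Hs & E).
    unfold p. rewrite E. split; [exact Hs | reflexivity]. }
  assert (Hv : vanishes_at (fun j => RtoC (p j)) z).
  { apply is_pseries_vanishes_at. revert Hser.
    apply is_series_ext. intros n. now rewrite (proj2 (Hp n)). }
  assert (P0 : 1 <= Rabs (p 0%nat)).
  { apply HN; [apply Hp|]. intros E. apply Hp0. now rewrite (proj2 (Hp 0%nat)), E. }
  assert (Hs : exists s, (s = 1 \/ s = -1) /\ 1 <= s * p 0%nat).
  { destruct (Rle_dec 0 (p 0%nat)).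
    - exists 1. split; [now left|]. rewrite Rabs_pos_eq in P0; lra.
    - exists (-1). split; [now right|]. rewrite Rabs_left in P0; lra. }
  assert (Ht : exists t, (t = 1 \/ t = -1) /\ 0 <= t * Re z).
  { destruct (Rle_dec 0 (Re z)).
    - exists 1. split; [now left | lra].
    - exists (-1). split; [now right | lra]. }
  destruct Hs as (s & Hs & Hs0), Ht as (t & Ht & Ht0).
  assert (As : Rabs s = 1)
    by (destruct Hs as [-> | ->]; [apply Rabs_R1 | rewrite Rabs_left; lra]).
  assert (At : Rabs t = 1)
    by (destruct Ht as [-> | ->]; [apply Rabs_R1 | rewrite Rabs_left; lra]).
  assert (Em : Cmod (RtoC t * z)%C = Cmod z)
    by (rewrite Cmod_mult, Cmod_R, At; ring).
  assert (ER : Re (RtoC t * z)%C = t * Re z)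
    by (unfold Re, Cmult, RtoC; simpl; ring).
  assert (EI : Im (RtoC t * z)%C = t * Im z)
    by (unfold Im, Cmult, RtoC; simpl; ring).
  exists (fun j => s * t ^ j * p j), (RtoC t * z)%C.
  rewrite Em, ER, EI. repeat split; try assumption.
  - intros j. apply sign_pow_mem; try assumption. apply Hp.
  - simpl. lra.
  - intros E. apply Him. destruct Ht as [-> | ->]; lra.
  - unfold vanishes_at. revert Hv. apply is_lim_seq_ext. intros n.
    rewrite psum_sign_change by (destruct Ht as [-> | ->]; ring).
    rewrite Cmod_mult, Cmod_R, As. ring.
Qed.

(** If [|l|] is within [eps] of the critical radius, finiteness of [S] turns
    the approximate information on [p_0] and [p_1] into [p_0 = 1] and
    [p_1 <= - (2 t + 1)], and then the series is [<= 0] at the critical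
    radius, against [positive_at_real]. *)
Lemma radius_gap (S : Ensemble R) (M : R) :
  Finite_sets.Finite R S -> symmetric_set S -> normalized S -> is_max S M ->
  exists eps, 0 < eps /\
    forall z, nonreal_Sigma S z -> 1 / (sqrt M + 1) + eps <= Cmod z.
Proof.
  intros HF HS HN [_ Hmax].
  assert (HM1 : 1 <= M) by (apply Hmax, HN).
  set (t := sqrt M).
  assert (Et : M = t ^ 2) by (unfold t; rewrite pow2_sqrt; lra).
  assert (Ht : 1 <= t) by (unfold t; rewrite <- sqrt_1; apply sqrt_le_1; lra).
  destruct (finite_right_gap S 1 HF) as (d1 & Hd1 & G1).
  destruct (finite_right_gap S (- (2 * t + 1)) HF) as (d2 & Hd2 & G2).
  destruct (bounds_near_critical_radius t d1 d2 Ht Hd1 Hd2) as (eps & He & Hb).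
  exists eps. split; [exact He|]. intros z Hz.
  destruct (nonreal_Sigma_wlog S z HS HN Hz)
    as (p & l & Hp & Hp0 & <- & Hl & Him & Hre & Hv).
  destruct (Rle_or_lt (1 / (t + 1) + eps) (Cmod l)) as [H|Hlt]; [exact H|exfalso].
  assert (HpM : forall j, Rabs (p j) <= t ^ 2).
  { intros j. rewrite <- Et. apply Rabs_le. split.
    - assert (- p j <= M) by (apply Hmax, HS; rewrite Ropp_involutive; apply Hp).
      lra.
    - apply Hmax, Hp. }
  destruct (coeff_constraints p (t ^ 2) l HpM Hp0 Hl Him Hre Hv) as (C0 & C2 & C1).
  assert (Hr : 0 < Cmod l) by (apply Cmod_gt_0, nonreal_neq_conj, Him).
  assert (Hr2 : 0 < Cmod l ^ 2) by (apply pow_lt; exact Hr).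
  assert (Hge : 1 / (t + 1) <= Cmod l).
  { apply Rle_div_l; [lra|].
    assert (1 <= (Cmod l * t / (1 - Cmod l)) ^ 2).
    { replace ((Cmod l * t / (1 - Cmod l)) ^ 2)
        with (Cmod l ^ 2 * (t ^ 2 / (1 - Cmod l) ^ 2)) by (field; lra). lra. }
    assert (0 <= Cmod l * t / (1 - Cmod l)) by (apply Rdiv_le_0_compat; nra).
    assert (D : 1 <= Cmod l * t / (1 - Cmod l)) by nra.
    apply Rle_div_r in D; lra. }
  destruct (Hb (Cmod l)) as (B0 & B1 & B2).
  { apply Rabs_def1; lra. }
  assert (P0 : p 0%nat = 1).
  { destruct Hp0 as [Hp0|Hp0]; [|auto].
    specialize (G1 _ (Hp 0%nat) Hp0). lra. }
  assert (P1 : p 1%nat <= - (2 * t + 1)).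
  { apply Rnot_lt_le. intros Hn. specialize (G2 _ (Hp 1%nat) Hn).
    assert (A : Cmod l - (t ^ 2 / (1 - Cmod l) ^ 2 - 1 / Cmod l ^ 2)
                   * (1 - Cmod l) / (2 * t ^ 2) <= Re l).
    { apply (Rmult_le_compat_r ((1 - Cmod l) / (2 * t ^ 2))) in C2.
      - replace (2 * (Cmod l - Re l) * (t ^ 2 / (1 - Cmod l)) *
          ((1 - Cmod l) / (2 * t ^ 2))) with (Cmod l - Re l) in C2
          by (field; lra).
        unfold Rdiv in *. lra.
      - apply Rdiv_le_0_compat; nra. }
    apply (Rmult_le_compat_r (2 / Cmod l ^ 2)) in A.
    - unfold Rdiv in *. lra.
    - apply Rdiv_le_0_compat; lra. }
  assert (T1 : 1 < t).
  { pose proof (HpM 1%nat) as H. apply Rabs_le_between in H. nra. }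
  assert (Hx : 0 <= 1 / (t + 1) < 1).
  { split; [apply Rdiv_le_0_compat; lra|]. apply Rlt_div_l; lra. }
  pose proof (positive_at_real p (t ^ 2) l (1 / (t + 1)) HpM Hp0 Hl Him Hv Hx
                (B2 T1)) as Hpos.
  rewrite P0 in Hpos.
  assert (p 1%nat * (1 / (t + 1)) <= - (2 * t + 1) * (1 / (t + 1)))
    by (apply Rmult_le_compat_r; lra).
  assert (E : 1 + - (2 * t + 1) * (1 / (t + 1)) +
    t ^ 2 * (1 / (t + 1)) ^ 2 / (1 - 1 / (t + 1)) = 0) by (field; lra).
  lra.
Qed.

(** * A nonreal zero of small modulus *)

(** The series is [1 - k z + M z^2 + M z^3 + ...], and [l] is a root of
    [1 - (k + 1) z + c z^2] with [c = M + k].  Its double quotient is the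
    constant sequence [c], so [g] is [(z - conj l) c / (1 - z)]. *)
Lemma extremal_zero (S : Ensemble R) (M k : R) :
  symmetric_set S -> normalized S -> is_max S M ->
  S k -> 1 <= k < 2 * sqrt M + 1 ->
  exists z, nonreal_Sigma S z /\ Cmod z = 1 / sqrt (M + k).
Proof.
  intros HS [H1 _] [HM Hmax] Hk [Hk1 Hk2].
  assert (HM1 : 1 <= M) by (apply Hmax, H1).
  set (c := M + k).
  assert (Hc : 2 <= c) by (unfold c; lra).
  assert (Hdisc : 0 < 4 * c - (k + 1) ^ 2).
  { assert (sqrt M ^ 2 = M) by (apply pow2_sqrt; lra).
    pose proof (sqrt_pos M). unfold c. nra. }
  set (l := ((k + 1) / (2 * c), sqrt (4 * c - (k + 1) ^ 2) / (2 * c)) : C).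
  assert (Hs : sqrt (4 * c - (k + 1) ^ 2) ^ 2 = 4 * c - (k + 1) ^ 2)
    by (apply pow2_sqrt; lra).
  assert (Hs0 : 0 < sqrt (4 * c - (k + 1) ^ 2)) by (apply sqrt_lt_R0, Hdisc).
  assert (Hmod2 : Cmod l ^ 2 = 1 / c).
  { rewrite Cmod2_alt. unfold l, Re, Im. cbn [fst snd].
    replace ((sqrt (4 * c - (k + 1) ^ 2) / (2 * c)) ^ 2)
      with (sqrt (4 * c - (k + 1) ^ 2) ^ 2 / (2 * c) ^ 2) by (field; lra).
    rewrite Hs. field. lra. }
  assert (Hmod : Cmod l = 1 / sqrt c).
  { rewrite <- (sqrt_pow2 (Cmod l)) by apply Cmod_ge_0.
    rewrite Hmod2, sqrt_div_alt, sqrt_1 by lra. reflexivity. }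
  assert (Hl1 : Cmod l < 1).
  { assert (1 / c < 1) by (apply Rlt_div_l; lra).
    pose proof (Cmod_ge_0 l). nra. }
  assert (Ec : RtoC c <> 0) by (intros E; apply RtoC_inj in E; lra).
  assert (Enorm : (l * Cconj l * RtoC c)%C = 1).
  { rewrite <- Cmod2_conj, Hmod2, <- RtoC_mult. f_equal. field. lra. }
  assert (Esum : ((l + Cconj l) * RtoC c)%C = RtoC (k + 1)).
  { assert (E : (l + Cconj l)%C = RtoC ((k + 1) / c)).
    { unfold l, Cconj, Cplus, RtoC. simpl. f_equal; field; lra. }
    rewrite E, <- RtoC_mult. f_equal. field. lra. }
  set (p := fun j : nat => match j with O => 1 | 1%nat => - k | _ => M end).
  set (g := fun j : nat => match j with
              | O => (- (Cconj l * RtoC c))%C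
              | _ => ((1 - Cconj l) * RtoC c)%C end).
  assert (Hq : quotient l (fun j => RtoC (p j)) g).
  { split.
    - simpl. rewrite <- Enorm. ring.
    - intros [|i]; simpl p; simpl g.
      + replace (RtoC (- k))
          with (l * Cconj l * RtoC c - (l + Cconj l) * RtoC c)%C
          by (rewrite Enorm, Esum, RtoC_plus, RtoC_opp; ring).
        ring.
      + replace (RtoC M)
          with (RtoC c - (l + Cconj l) * RtoC c + l * Cconj l * RtoC c)%C
          by (rewrite Enorm, Esum; unfold c; rewrite !RtoC_plus; ring).
        ring. }
  exists l. split; [|exact Hmod].
  split; [split|].
  - exact Hl1.
  - exists (fun j => RtoC (p j)). split; [|split].
    + intros j. exists (p j). split; [|reflexivity].
      destruct j as [|[|j]]; simpl; [exact H1 | apply HS | exact HM].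
      now rewrite Ropp_involutive.
    + simpl. intros E. apply RtoC_inj in E. lra.
    + apply is_pseries_vanishes_at.
      apply (vanishes_of_quotient l _ g (Rmax (Cmod (g 0%nat)) (Cmod (g 1%nat))));
        [exact Hl1 | exact Hq |].
      intros [|i]; [apply Rmax_l | apply Rmax_r].
  - unfold real_line, In, l, Im. simpl. intros E.
    assert (0 < sqrt (4 * c - (k + 1) ^ 2) / (2 * c))
      by (apply Rdiv_lt_0_compat; lra).
    simpl in *. lra.
Qed.

(** * The theorem *)

Theorem theorem4p4 (S : Ensemble R) (M : R)
  (S_finite : Finite_sets.Finite R S) (S_nonempty : Inhabited R S)
  (S_symmetric : symmetric_set S) (S_normalized : normalized S)
  (M_max : is_max S M) :
  (~ exists lam : nat -> C,
       (forall n, nonreal_Sigma S (lam n)) /\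
       is_lim_seq (fun n => Cmod (lam n)) (Finite (1 / (sqrt M + 1)))) /\
  Rbar_lt (Finite (1 / (sqrt M + 1))) (rho_out S) /\
  (forall k : R,
     is_max (fun s => S s /\ 1 <= s < 2 * sqrt M + 1) k ->
     Rbar_le (rho_out S) (Finite (1 / sqrt (M + k)))).
Proof.
  destruct (radius_gap S M S_finite S_symmetric S_normalized M_max)
    as (eps & Heps & Hgap).
  split; [|split].
  - intros (lam & Hlam & Hlim).
    assert (H : Rbar_le (1 / (sqrt M + 1) + eps) (1 / (sqrt M + 1))).
    { apply (is_lim_seq_le (fun _ => 1 / (sqrt M + 1) + eps)
               (fun n => Cmod (lam n))).
      - intros n. apply Hgap, Hlam.
      - apply is_lim_seq_const.
      - exact Hlim. }
    simpl in H. lra.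
  - apply Rbar_lt_le_trans with (1 / (sqrt M + 1) + eps).
    + simpl. lra.
    + apply (proj1 (Lub_Rbar_correct _)). split.
      * pose proof (sqrt_pos M).
        assert (0 < 1 / (sqrt M + 1)) by (apply Rdiv_lt_0_compat; lra). lra.
      * intros z Hz. split; [now apply Hgap|].
        exact (proj1 (proj1 Hz)).
  - intros k [[Hk Hk1] _].
    destruct (extremal_zero S M k S_symmetric S_normalized M_max Hk Hk1)
      as (z & Hz & Hmod).
    apply (proj2 (Lub_Rbar_correct _)). intros r [_ Hr].
    simpl. rewrite <- Hmod. apply (Hr z Hz).
Qed.
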